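(* Let $n$ be a positive integer. For every $i$ with $0\le i\le n-1$, the number of signed permutations in $\mathfrak{B}_n$ with exactly $i+1$ augmented descents is $2^n$ times the number of permutations in $\mathfrak{S}_n$ with exactly $i$ descents. In other words, $$A_n^{(a)}(t)=2^n A_n(t),$$ where $A_n^{(a)}(t)=\sum_{\pi\in\mathfrak{B}_n}t^{\operatorname{ades}(\pi)}$ and $A_n(t)=\sum_{\pi\in\mathfrak{S}_n}t^{\operatorname{des}(\pi)+1}$.
   Context: $\mathfrak{S}_n$ is the symmetric group of bijections of $\{1,\ldots,n\}$. For $\pi\in\mathfrak{S}_n$, the number of descents $\operatorname{des}(\pi)$ is the number of $i\in\{1,\ldots,n-1\}$ with $\pi(i)>\pi(i+1)$. $\mathfrak{B}_n$ is the hyperoctahedral group: the group of all bijections $\pi$ of $\{-n,\ldots,-1,0,1,\ldots,n\}$ with $\pi(-s)=-\pi(s)$ for $s=0,1,\ldots,n$ (so $\pi(0)=0$); its elements are called signed permutations. A signed permutation $\pi\in\mathfrak{B}_n$ has an augmented descent at position $i\in\{0,1,\ldots,n\}$ if $0\le i\le n-1$ and $\pi(i)>\pi(i+1)$, or if $i=n$ and $\pi(n)>0$. The augmented descent number $\operatorname{ades}(\pi)$ is the number of augmented descents of $\pi$. *)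

(* Defs.v *)
From mathcomp Require Import all_boot all_order all_algebra all_fingroup.

Set Implicit Arguments.
Unset Strict Implicit.
Unset Printing Implicit Defensive.

Import Order.TTheory GRing.Theory Num.Theory.
Local Open Scope ring_scope.

(* Permutations of {1, ..., n} are elements of 'S_n, with entries shifted to
   {0, ..., n-1}.  A descent is a position i having a successor j in the range
   with p i > p j. *)
Definition descent n (p : 'S_n) (i : 'I_n) : bool :=
  [exists j : 'I_n, (j == i.+1 :> nat) && (p j < p i)%N].

Definition des n (p : 'S_n) : nat := #|[set i : 'I_n | descent p i]|.

(* The set {-n, ..., n} is encoded as 'I_(n.*2.+1), the ordinal k standing for
   the integer k - n; sord is only meaningful for `|z| <= n. *)
Definition sint n (k : 'I_(n.*2.+1)) : int := k%:Z - n%:Z.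
Definition sord n (z : int) : 'I_(n.*2.+1) := inord (absz (n%:Z + z)).

Lemma sintK n : cancel (@sint n) (sord n).
Proof. by move=> k; rewrite /sord /sint addrC subrK /= inord_val. Qed.

Lemma sordK n (z : int) : - n%:Z <= z <= n%:Z -> sint (sord n z) = z.
Proof.
move=> /andP[lez zle]; rewrite /sint /sord.
have nz_ge0 : 0 <= n%:Z + z by rewrite -lerBlDl sub0r.
rewrite inordK ?gez0_abs //; first by rewrite addrC addKr.
by rewrite ltnS -lez_nat gez0_abs // -addnn PoszD lerD2l.
Qed.

Lemma sint_rev n (k : 'I_(n.*2.+1)) : sint (rev_ord k) = - sint k.
Proof.
rewrite /sint /= subSS -subzn; last by rewrite -ltnS ltn_ord.
have -> : (n.*2)%:Z = n%:Z + n%:Z by rewrite -PoszD addnn.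
by rewrite opprB addrAC addrK.
Qed.

Definition sapp n (p : {perm 'I_(n.*2.+1)}) (z : int) : int :=
  sint (p (sord n z)).

Definition hyperoctahedral n : {set {perm 'I_(n.*2.+1)}} :=
  [set p | [forall s : 'I_n.+1, sapp p (- s%:Z) == - sapp p s%:Z]].

Lemma hyperoctahedralP n (p : {perm 'I_(n.*2.+1)}) :
  reflect (forall k, p (rev_ord k) = rev_ord (p k)) (p \in hyperoctahedral n).
Proof.
have sordN (z : int) : - n%:Z <= z <= n%:Z ->
    sord n (- z) = rev_ord (sord n z).
  move=> zb; apply/(can_inj (@sintK n)).
  by rewrite sint_rev !sordK // lerN2 lerNl andbC.
have natb (s : 'I_n.+1) : - n%:Z <= s%:Z <= n%:Z.
  by rewrite lez_nat -ltnS ltn_ord andbT (le_trans (y := 0)) // oppr_le0.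
rewrite inE; apply: (iffP forallP) => [h k | h s]; last first.
  by rewrite /sapp sordN // h sint_rev.
have half (k' : 'I_(n.*2.+1)) : (n <= k')%N -> p (rev_ord k') = rev_ord (p k').
  move=> nk; have ks : (k' - n < n.+1)%N.
    by rewrite ltnS leq_subLR addnn -ltnS ltn_ord.
  move/eqP: (h (Ordinal ks)); rewrite /sapp /= sordN; last first.
    exact: (natb (Ordinal ks)).
  by rewrite -subzn // -/(sint k') sintK -sint_rev => /(can_inj (@sintK n)).
have [/half //|kn] := leqP n k.
have /half : (n <= rev_ord k)%N.
  by rewrite /= subSS (leq_trans _ (leq_sub2l _ (ltnW kn))) // -addnn addnK.
by rewrite rev_ordK => ->; rewrite rev_ordK.
Qed.

Lemma hyperoctahedral_group_set n : group_set (hyperoctahedral n).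
Proof.
apply/group_setP; split; first by apply/hyperoctahedralP => k; rewrite !perm1.
move=> p q /hyperoctahedralP hp /hyperoctahedralP hq.
by apply/hyperoctahedralP => k; rewrite !permM hp hq.
Qed.

Canonical hyperoctahedral_group n := Group (hyperoctahedral_group_set n).

Definition aug_descent n (p : {perm 'I_(n.*2.+1)}) (i : 'I_n.+1) : bool :=
  if (i < n)%N then sapp p i.+1%:Z < sapp p i%:Z else 0 < sapp p n%:Z.

Definition ades n (p : {perm 'I_(n.*2.+1)}) : nat :=
  #|[set i : 'I_n.+1 | aug_descent p i]|.

Definition eulerian_poly n : {poly int} := \sum_(p : 'S_n) 'X^((des p).+1).

Definition aug_eulerian_poly n : {poly int} :=
  \sum_(p in hyperoctahedral n) 'X^(ades p).

(* Main.v *)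
Require Import Defs.
From mathcomp Require Import all_boot all_order all_algebra all_fingroup.
From mathcomp Require Import zify.

Import GRing.Theory.
Local Open Scope ring_scope.

Set Implicit Arguments.
Unset Strict Implicit.
Unset Printing Implicit Defensive.

(** Reorder the letters so that 0 comes first, then the positive letters in
    increasing order, then the negative ones in increasing order.  Along the
    closed word 0, p(1), ..., p(n), 0 this changes each descent indicator by the
    difference of the negativity indicators of two consecutive letters, so the
    number of descents is unchanged.  In the new order 0 is minimal, hence the
    descents are those of p(1), ..., p(n) plus a final one.  A signed permutation
    is given by the set A of its positive letters and by the permutation
    obtained by replacing each letter with its rank in the new order; there are
    2 ^ n choices of A. *)

(** * The new order on letters and descents of closed words *)

Definition prec (x y : int) : bool :=
  [|| 0 <= x < y, x < y < 0 | y < 0 <= x].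

Lemma prec_irr : irreflexive prec.
Proof. by move=> x; rewrite /prec; lia. Qed.

Lemma prec_trans : transitive prec.
Proof. by move=> y x z; rewrite /prec; lia. Qed.

Lemma lt_prec (x y : int) : ((x < y)%R + (y < 0)%R = prec x y + (x < 0)%R)%N.
Proof. by rewrite /prec; lia. Qed.

Lemma sum_lt_prec (c : nat -> int) m : c m = c 0%N ->
  (\sum_(i < m) (c i.+1 < c i)%R = \sum_(i < m) prec (c i.+1) (c i))%N.
Proof.
(* Closedness turns the right-hand [c 0 < 0] into [c m < 0]. The resulting identity holds for open
   words too, so induction on [m] telescopes [lt_prec]. *)
move=> c_cyc; apply/(@addIn (c 0%N < 0)%R); rewrite -{2}c_cyc {c_cyc}.
elim: m => [|m IHm]; first by rewrite !big_ord0.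
rewrite !big_ord_recr /= addnAC IHm -!addnA; congr addn.
by rewrite addnC lt_prec.
Qed.

Lemma prec_nth (l : seq int) a b : sorted prec l ->
  (a < size l)%N -> (b < size l)%N -> prec (nth 0 l a) (nth 0 l b) = (a < b)%N.
Proof.
move=> l_sorted al bl.
have incr := sorted_ltn_nth prec_trans 0 l_sorted.
case: (ltngtP a b) => [ab|ba|->]; last exact: prec_irr.
- exact: incr.
- apply/negP => /prec_trans/(_ (incr _ _ bl al ba)).
  by rewrite prec_irr.
Qed.

(** * The letters available for a given positive set, in the new order *)

Lemma sorted_enum_ord n (A : {set 'I_n}) :
  sorted (fun i j : 'I_n => (i < j)%N) (enum A).
Proof.
rewrite /enum_mem -enumT; apply: sorted_filter; first by move=> ? ? ?; apply: ltn_trans.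
by rewrite -(sorted_map (f := val) (e' := ltn)) val_enum_ord iota_ltn_sorted.
Qed.

(** The reversal makes the negative letters increase, so an index in this list is a rank for
    [prec]. *)
Definition letters {n} (A : {set 'I_n}) : seq int :=
  [seq i.+1%:Z | i : 'I_n <- enum A] ++
  rev [seq - i.+1%:Z | i : 'I_n <- enum (~: A)].

Lemma size_letters n (A : {set 'I_n}) : size (letters A) = n.
Proof. by rewrite size_cat size_rev !size_map -!cardE cardsC card_ord. Qed.

Lemma lettersP n (A : {set 'I_n}) (z : int) :
  reflect (exists i : 'I_n, z = if i \in A then i.+1%:Z else - i.+1%:Z)
          (z \in letters A).
Proof.
rewrite mem_cat mem_rev; apply: (iffP orP) => [|[i ->]].
  by case=> /mapP[i]; rewrite mem_enum ?inE => iA ->; exists i;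
     rewrite ?iA ?(negPf iA).
case: ifP => iA; [left | right]; apply/mapP; exists i => //;
  by rewrite mem_enum ?inE iA.
Qed.

Lemma sorted_letters n (A : {set 'I_n}) : sorted prec (0 :: letters A).
Proof.
rewrite sorted_pairwise; last exact: prec_trans.
rewrite /= pairwise_cat; apply/and4P; split.
- by apply/allP => z /lettersP[i ->]; case: (i \in A); rewrite /prec; lia.
- apply/allrelP => x y; rewrite mem_rev => /mapP[i _ ->] /mapP[j _ ->].
  by rewrite /prec; lia.
- rewrite -sorted_pairwise; last exact: prec_trans.
  rewrite sorted_map; apply: sub_sorted (sorted_enum_ord A) => i j.
  by rewrite /prec /=; lia.
- rewrite -sorted_pairwise; last exact: prec_trans.
  rewrite rev_sorted sorted_map; apply: sub_sorted (sorted_enum_ord (~: A)) => i j.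
  by rewrite /prec /=; lia.
Qed.

Lemma uniq_letters n (A : {set 'I_n}) : uniq (letters A).
Proof.
by have /andP[] := sorted_uniq prec_trans prec_irr (sorted_letters A).
Qed.

(** Membership in [A] decides the sign, so each absolute value occurs with one sign only. *)
Lemma absz_letters_inj n (A : {set 'I_n}) :
  {in letters A &, injective absz}.
Proof.
move=> x y /lettersP[i ->] /lettersP[j ->] ij.
suff -> : i = j by [].
by apply/val_inj; move: ij; do 2!case: ifP => _ /=; lia.
Qed.

(** * Odd extension of a word to a signed permutation *)

Definition odd_ext {n} (u : 'I_n -> int) (z : int) : int :=
  match z with
  | Posz 0 => 0
  | Posz k.+1 => oapp u 0 (insub k)
  | Negz k => - oapp u 0 (insub k)
  end.

Lemma odd_extN n (u : 'I_n -> int) z : odd_ext u (- z) = - odd_ext u z.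
Proof. by case: z => [[|k]|k] //=; rewrite opprK. Qed.

Lemma odd_ext_ord n (u : 'I_n -> int) (i : 'I_n) : odd_ext u i.+1%:Z = u i.
Proof. by rewrite /= valK. Qed.

Variant signed_letter_spec n : int -> Prop :=
  | SignedZero : signed_letter_spec n 0
  | SignedPos (i : 'I_n) : signed_letter_spec n i.+1%:Z
  | SignedNeg (i : 'I_n) : signed_letter_spec n (- i.+1%:Z).

Lemma signed_letterP n (z : int) :
  - n%:Z <= z <= n%:Z -> signed_letter_spec n z.
Proof.
case: z => [[|k]|k] zn; first exact: SignedZero.
- have kn : (k < n)%N by lia.
  exact: (SignedPos (Ordinal kn)).
- have kn : (k < n)%N by lia.
  exact: (SignedNeg (Ordinal kn)).
Qed.

Lemma sint_bound n (k : 'I_(n.*2.+1)) : - n%:Z <= sint k <= n%:Z.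
Proof. by have := ltn_ord k; rewrite /sint; lia. Qed.

Section OddExtension.

Variables (n : nat) (u : 'I_n -> int).
Hypotheses (u_inj : injective (fun i => absz (u i))).
Hypotheses (u_neq0 : forall i, u i != 0) (u_bound : forall i, (absz (u i) <= n)%N).

Lemma odd_ext_bound z : - n%:Z <= odd_ext u z <= n%:Z.
Proof.
have o_bound k : - n%:Z <= oapp u 0 (insub k) <= n%:Z.
  by case: insubP => [i _ _|_] /=; [have := u_bound i|]; lia.
by case: z => [[|k]|k] //=; [lia|have := o_bound k; lia].
Qed.

Lemma odd_ext_perm_inj :
  injective (fun k : 'I_(n.*2.+1) => sord n (odd_ext u (sint k))).
Proof.
move=> k k' /(congr1 (@sint n)); rewrite !sordK ?odd_ext_bound // => eq_kk'.
apply/(can_inj (@sintK n)); move: eq_kk'.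
case: (signed_letterP (sint_bound k)) => [|i|i];
  case: (signed_letterP (sint_bound k')) => [|j|j] //;
  rewrite ?odd_extN ?odd_ext_ord /= => e;
  try by [move: (u_neq0 j); lia | move: (u_neq0 i); lia].
(* Both arguments are now nonzero and their images agree up to sign, so [u_inj] applies. Arguments
   of opposite sign would force [u j = 0]. *)
all: have ij : i = j by apply: u_inj => /=; lia.
all: by move: e; rewrite ij //; move: (u_neq0 j); lia.
Qed.

Lemma sapp_odd_ext (p : {perm 'I_(n.*2.+1)}) :
  (forall k, p k = sord n (odd_ext u (sint k))) ->
  forall z, - n%:Z <= z <= n%:Z -> sapp p z = odd_ext u z.
Proof. by move=> pE z zn; rewrite /sapp pE !sordK ?odd_ext_bound. Qed.

End OddExtension.

(** * The signed permutation with prescribed ranks and positive letters *)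

Section SignedPermOf.

Variables (n : nat) (x : 'S_n * {set 'I_n}).

Definition ranked_word (i : 'I_n) : int := nth 0 (letters x.2) (x.1 i).

Lemma ranked_word_mem i : ranked_word i \in letters x.2.
Proof. by rewrite mem_nth // size_letters. Qed.

Lemma ranked_word_inj : injective (fun i => absz (ranked_word i)).
Proof.
move=> i j /(absz_letters_inj (ranked_word_mem i) (ranked_word_mem j)).
move/eqP; rewrite nth_uniq ?size_letters ?uniq_letters // => /eqP ij.
exact/(@perm_inj _ x.1)/val_inj.
Qed.

Lemma ranked_word_neq0 i : ranked_word i != 0.
Proof. by have /lettersP[j ->] := ranked_word_mem i; case: ifP; lia. Qed.

Lemma ranked_word_bound i : (absz (ranked_word i) <= n)%N.
Proof.
by have /lettersP[j ->] := ranked_word_mem i; have := ltn_ord j; case: ifP; lia.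
Qed.

Definition signed_perm_of : {perm 'I_(n.*2.+1)} :=
  perm (@odd_ext_perm_inj n _ ranked_word_inj ranked_word_neq0 ranked_word_bound).

Lemma sapp_signed_perm_of z :
  - n%:Z <= z <= n%:Z -> sapp signed_perm_of z = odd_ext ranked_word z.
Proof.
by apply: sapp_odd_ext => [|k]; [exact: ranked_word_bound | rewrite permE].
Qed.

Lemma sapp_signed_perm_of_ord (i : 'I_n) :
  sapp signed_perm_of i.+1%:Z = ranked_word i.
Proof. by rewrite sapp_signed_perm_of ?odd_ext_ord //; have := ltn_ord i; lia. Qed.

Lemma signed_perm_of_hyperoctahedral : signed_perm_of \in hyperoctahedral n.
Proof.
rewrite inE; apply/forallP => s; have := ltn_ord s => sn.
by rewrite !sapp_signed_perm_of ?odd_extN //; lia.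
Qed.

(* The value 0 is taken at k = 0 and at k > n, which closes the word. *)
Definition rank_word (k : nat) : nat :=
  if k is j.+1 then oapp (fun i => (x.1 i).+1) 0%N (insub j) else 0%N.

(** Putting 0 at the head of the list shifts ranks by one, and the default rank 0 then matches the
    default value 0 beyond [n]. *)
Lemma odd_ext_rank_word (k : nat) :
  odd_ext ranked_word k = nth 0 (0 :: letters x.2) (rank_word k).
Proof. by case: k => //= k; case: insubP. Qed.

Lemma rank_word_bound k : (rank_word k < n.+1)%N.
Proof. by case: k => //= k; case: insubP => //= i _ _; rewrite ltnS. Qed.

(** Position 0 is never a descent because rank 0 is minimal. Position [n] always is one, as the word
    returns to 0; this is the extra 1. *)
Lemma sum_rank_word : (0 < n)%N ->
  (\sum_(i < n.+1) (rank_word i.+1 < rank_word i) = (des x.1).+1)%N.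
Proof.
move=> n_gt0; rewrite big_ord_recl ltn0 add0n /des -sum1_card [in RHS]big_mkcond /=.
have eqi (i : 'I_n) : (rank_word i.+2 < rank_word i.+1)%N =
    (descent x.1 i + (i.+1 == n) :> nat)%N :> nat.
  rewrite {2}/rank_word valK /= /descent; case: (insubP 'I_n) => /= [j jn ji|].
    rewrite ltnS (ltn_eqF jn) addn0; congr nat_of_bool; apply/idP/existsP.
      by exists j; rewrite ji eqxx.
    by case=> k /andP[/eqP ki]; rewrite (_ : k = j) //; apply: ord_inj; rewrite ki ji.
  rewrite -leqNgt => ni; have -> : i.+1 == n by rewrite eqn_leq ltn_ord.
  case: existsP => // -[j /andP[/eqP ji]]; have := ltn_ord j.
  by rewrite ji ltnNge ni.
rewrite (eq_bigr _ (fun i _ => eqi i)) big_split /= -addn1; congr addn.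
  by apply: eq_bigr => i _; rewrite inE; case: descent.
have predn_lt : (n.-1 < n)%N by rewrite prednK.
rewrite (bigD1 (Ordinal predn_lt)) //= prednK // eqxx big1 // => i.
by rewrite -val_eqE /=; lia.
Qed.

Lemma ades_signed_perm_of : (0 < n)%N -> ades signed_perm_of = (des x.1).+1.
Proof.
move=> n_gt0; rewrite -sum_rank_word // /ades -sum1_card big_mkcond /=.
(* The default 0 at [n.+1] closes the word, so the last augmented descent, a positive value at [n],
   becomes an ordinary descent to 0. *)
pose c k := odd_ext ranked_word (Posz k).
have c_last : c n.+1 = 0.
  by rewrite /c /=; case: insubP => //= i; rewrite ltnn.
transitivity (\sum_(i < n.+1) (c i.+1 < c i)%R)%N.
  apply: eq_bigr => i _; rewrite inE /aug_descent; have := ltn_ord i => i_le.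
  case: (ltnP i n) => [i_lt|i_ge]; first by rewrite !sapp_signed_perm_of; [case: ifP|lia|lia].
  have -> : i = n :> nat by lia.
  by rewrite sapp_signed_perm_of ?c_last; [case: ifP|lia].
rewrite sum_lt_prec ?c_last //; apply: eq_bigr => i _.
by rewrite /c !odd_ext_rank_word prec_nth ?sorted_letters //;
   rewrite [size _]/= size_letters rank_word_bound.
Qed.

End SignedPermOf.

(** * Each signed permutation comes from exactly one pair; counting *)

Lemma signed_perm_of_inj n : injective (@signed_perm_of n).
Proof.
move=> x y xy.
have word_xy i : ranked_word x i = ranked_word y i.
  by rewrite -!sapp_signed_perm_of_ord xy.
(* A permutation of ranks is onto, so every available letter occurs in the word; hence the word
   determines the positive set. *)
have subset_pos (z w : 'S_n * {set 'I_n}) : (forall i, ranked_word z i = ranked_word w i) ->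
    z.2 \subset w.2.
  move=> zw; apply/subsetP => v vz.
  have vL : v.+1%:Z \in letters z.2 by apply/lettersP; exists v; rewrite vz.
  have rL : (index v.+1%:Z (letters z.2) < n)%N.
    by move: vL; rewrite -index_mem size_letters.
  have := ranked_word_mem w ((z.1)^-1%g (Ordinal rL)).
  rewrite -zw /ranked_word permKV nth_index // => /lettersP[j].
  by case: ifP => [jw e|]; [rewrite (_ : v = j) //; apply: val_inj => /=; lia | lia].
have eq2 : x.2 = y.2 by apply/eqP; rewrite eqEsubset !subset_pos.
apply/eqP; rewrite -pair_eqE /= eq2 eqxx andbT; apply/eqP/permP => i.
apply/val_inj/eqP; have /eqP := word_xy i.
by rewrite /ranked_word eq2 nth_uniq ?size_letters ?uniq_letters.
Qed.

Lemma sapp_hyperoctahedralN n (p : {perm 'I_(n.*2.+1)}) (z : int) :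
  p \in hyperoctahedral n -> - n%:Z <= z <= n%:Z -> sapp p (- z) = - sapp p z.
Proof.
rewrite inE => /forallP p_odd; wlog z_ge0 : z / 0 <= z.
  move=> IH zn; have [|z_lt0] := boolP (0 <= z); first by move/IH; apply.
  by have := IH (- z); rewrite opprK => ->; [rewrite opprK|lia|lia].
case: z z_ge0 => // k _ kn; have k_lt : (k < n.+1)%N by lia.
by have /eqP := p_odd (Ordinal k_lt).
Qed.

Lemma sapp_inj n (p : {perm 'I_(n.*2.+1)}) (z w : int) :
  - n%:Z <= z <= n%:Z -> - n%:Z <= w <= n%:Z -> sapp p z = sapp p w -> z = w.
Proof.
move=> zn wn /(can_inj (@sintK n))/perm_inj/(congr1 (@sint n)).
by rewrite !sordK.
Qed.

Lemma hyperoctahedral_imset n :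
  hyperoctahedral n = [set signed_perm_of x | x in [set: 'S_n * {set 'I_n}]].
Proof.
apply/setP => p; apply/idP/imsetP; last first.
  by case=> x _ ->; exact: signed_perm_of_hyperoctahedral.
move=> pB.
have i_bound (i : 'I_n) : - n%:Z <= i.+1%:Z <= n%:Z by have := ltn_ord i; lia.
have p0 : sapp p 0 = 0.
  have : sapp p (- 0) = - sapp p 0 by apply: sapp_hyperoctahedralN => //; lia.
  by rewrite oppr0; move: (sapp p 0) => z; lia.
pose A := [set v : 'I_n | [exists i : 'I_n, sapp p i.+1%:Z == v.+1%:Z]].
have pL (i : 'I_n) : sapp p i.+1%:Z \in letters A.
  case E: _ / (signed_letterP (sint_bound (p (sord n i.+1%:Z)))) => [|v|v].
  - suff : i.+1%:Z = 0 by lia.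
    by apply: (sapp_inj (p := p)) => //; [lia | rewrite p0].
  - apply/lettersP; exists v; rewrite inE.
    by case: existsP => // -[]; exists i; apply/eqP.
  (* If the letter at [i] is [- v.+1] while [v.+1] occurs at some [j], oddness gives the same value
     at [- j.+1] and at [i.+1], against injectivity. *)
  apply/lettersP; exists v; rewrite inE.
  case: existsP => // -[j /eqP jv].
  suff : i.+1%:Z = - j.+1%:Z by lia.
  apply: (sapp_inj (p := p)) => //; first by have := i_bound j; lia.
  by rewrite sapp_hyperoctahedralN // jv.
(* The permutation sought sends each position to the rank of its letter. *)
have rank_lt (i : 'I_n) : (index (sapp p i.+1%:Z) (letters A) < n)%N.
  by have := pL i; rewrite -index_mem size_letters.
have rank_inj : injective (fun i => Ordinal (rank_lt i)).
  move=> i j [] /(congr1 (nth 0 (letters A))).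
  rewrite !nth_index // => /sapp_inj; move/(_ (i_bound i) (i_bound j)) => e.
  by apply: val_inj => /=; lia.
exists (perm rank_inj, A) => //; set x := (_, A).
have eq_pos (i : 'I_n) : sapp p i.+1%:Z = sapp (signed_perm_of x) i.+1%:Z.
  by rewrite sapp_signed_perm_of_ord /ranked_word /= permE nth_index.
have xB := signed_perm_of_hyperoctahedral x.
suff eq_sapp z : - n%:Z <= z <= n%:Z -> sapp p z = sapp (signed_perm_of x) z.
  apply/permP => k; apply/(can_inj (@sintK n)).
  by have := eq_sapp _ (sint_bound k); rewrite /sapp sintK.
case/signed_letterP => [|i|i]; first by rewrite p0 sapp_signed_perm_of //; lia.
- exact: eq_pos.
- by rewrite !sapp_hyperoctahedralN // eq_pos.
Qed.

(** An arbitrary weight [F] serves both claims: an indicator in [nat] gives the counts, a power of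
    ['X] the polynomials. *)
Lemma sum_ades (V : nmodType) (F : nat -> V) n : (0 < n)%N ->
  \sum_(p in hyperoctahedral n) F (ades p) =
    (\sum_(s : 'S_n) F (des s).+1) *+ 2 ^ n.
Proof.
move=> n_gt0; rewrite hyperoctahedral_imset big_imset /=; last first.
  by move=> x y _ _; exact: signed_perm_of_inj.
rewrite (eq_bigl xpredT) => [|x]; last by rewrite inE.
rewrite (eq_bigr (fun x => F (des x.1).+1)) => [|x _]; last first.
  by rewrite ades_signed_perm_of.
rewrite -(pair_bigA _ (fun s (A : {set 'I_n}) => F (des s).+1)) /= -sumrMnl.
apply: eq_bigr => s _; rewrite sumr_const; congr (_ *+ _).
(* The summand does not depend on [A], which ranges over [2 ^ n] subsets. *)
by rewrite -cardsT -powersetT card_powerset cardsT card_ord.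
Qed.

Unset Implicit Arguments.

Theorem proposition1p2 (n : nat) (n_gt0 : (0 < n)%N) :
  (forall i : nat, (i <= n - 1)%N ->
     #|[set p in hyperoctahedral n | ades p == i.+1]| =
       (2 ^ n * #|[set p : 'S_n | des p == i]|)%N) /\
  aug_eulerian_poly n = 2 ^+ n *: eulerian_poly n.
Proof.
split=> [i _|]; last first.
  by rewrite /aug_eulerian_poly sum_ades // -natrX scaler_nat.
rewrite -sum1_card (eq_bigl _ _ (in_set _)) big_mkcondr.
rewrite (sum_ades (fun k => if k == i.+1 then 1%N else 0%N) n_gt0).
rewrite -mulr_natl natn -sum1_card [in RHS]big_mkcond; congr muln.
by apply: eq_bigr => s _; rewrite inE eqSS.
Qed.
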